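(* Let $i\in\{1,2,3\}$ and let $n,x,y$ be positive integers. Then $$(n)\oplus_i^{[1,2,\ldots,n-1]}(x\oplus_{i-1}y)\;=\;(n)\oplus_i^{\mathrm{Even}}x\;\oplus_{i-1}^{[0]}\;(n)\oplus_i^{\mathrm{Odd}}y ,$$ where $\mathrm{Even}=[2n-2,2n-4,\ldots,4,2]$ and $\mathrm{Odd}=[1,3,\ldots,2n-5,2n-3]$. Explicitly, writing $\oplus$ for $\oplus_{i-1}$, define $L_1=x\oplus y$ and $L_{k+1}=L_k\oplus(x\oplus y)$, and define $R_1=x\oplus y$ and $R_{k+1}=x\oplus(R_k\oplus y)$. Then $L_n=R_n$ for every $n\ge 1$.
   Context: The operations on positive integers are $a\oplus_0 b=a+b$, $a\oplus_1 b=a\cdot b$, $a\oplus_2 b=b^a$ (note the order). A superscript on an operation sign replaces parentheses: in an unparenthesized string $z_1\oplus^{[s_1]}z_2\oplus^{[s_2]}\cdots\oplus^{[s_{r-1}]}z_r$ the operations are carried out in increasing order of their superscripts. The expression $(n)\oplus_i^{[s_1,\ldots,s_{n-1}]}z$ abbreviates the string $z\oplus_{i-1}^{[s_1]}z\oplus_{i-1}^{[s_2]}\cdots\oplus_{i-1}^{[s_{n-1}]}z$ with $n$ copies of $z$ (for $n=1$ it is just $z$). Hence the left-hand side is $n$ copies of $(x\oplus_{i-1}y)$ composed from left to right, and the right-hand side is the string $$x\oplus_{i-1}^{[2n-2]}x\oplus_{i-1}^{[2n-4]}\cdots\oplus_{i-1}^{[2]}x\oplus_{i-1}^{[0]}y\oplus_{i-1}^{[1]}y\oplus_{i-1}^{[3]}\cdots\oplus_{i-1}^{[2n-3]}y$$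 with $n$ copies of $x$ and $n$ copies of $y$, evaluated in increasing order of the superscripts $0,1,2,\ldots,2n-2$. *)

(* Defs.v *)
From mathcomp Require Import all_boot.

Set Implicit Arguments.
Unset Strict Implicit.
Unset Printing Implicit Defensive.

(* Only the levels 0, 1 and 2 are meaningful.  At level 2 the right operand
   is the base of the power. *)
Definition oplus (j a b : nat) : nat :=
  match j with
  | 0 => a + b
  | 1 => a * b
  | _ => b ^ a
  end.

(* The string z_1 (+)_{j_1}^{[s_1]} z_2 ... (+)_{j_(r-1)}^{[s_(r-1)]} z_r has
   operands [:: z_1; ...; z_r] and
   signs [:: (j_1, s_1); ...; (j_(r-1), s_(r-1))]. *)
Record opstring := OpString {
  operands : seq nat;
  signs : seq (nat * nat)
}.

Definition level (sg : nat * nat) : nat := sg.1.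
Definition superscript (sg : nat * nat) : nat := sg.2.

(* The position of the sign with the least superscript, the leftmost one in
   case of a tie. *)
Definition next_pos (w : opstring) : nat :=
  let ss := map superscript (signs w) in
  find (fun s => all (leq s) ss) ss.

(* Position k refers to the sign between the operands number k and k.+1,
   counted from 0. *)
Definition contract (k : nat) (w : opstring) : opstring :=
  let zs := operands w in
  let sg := signs w in
  OpString
    (take k zs ++
       oplus (level (nth (0, 0) sg k)) (nth 0 zs k) (nth 0 zs k.+1)
         :: drop k.+2 zs)
    (take k sg ++ drop k.+1 sg).

Definition eval_step (w : opstring) : opstring := contract (next_pos w) w.

(* One step per sign; a single operand is then left. *)
Definition eval (w : opstring) : nat :=
  head 0 (operands (iter (size (signs w)) eval_step w)).

(* (n) (+)_i^{ss} z, a string, not yet a value; ss is meant to have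
   n - 1 entries. *)
Definition copies (n i : nat) (ss : seq nat) (z : nat) : opstring :=
  OpString (nseq n z) [seq (i.-1, s) | s <- ss].

(* v (+)_j^{[s]} w, by juxtaposition of unparenthesized strings. *)
Definition join (v : opstring) (j s : nat) (w : opstring) : opstring :=
  OpString (operands v ++ operands w) (signs v ++ (j, s) :: signs w).

(* [:: 2n-2; 2n-4; ...; 4; 2] *)
Definition Even (n : nat) : seq nat := rev [seq 2 * k | k <- iota 1 n.-1].

(* [:: 1; 3; ...; 2n-5; 2n-3] *)
Definition Odd (n : nat) : seq nat := [seq (2 * k).+1 | k <- iota 0 n.-1].

(* L_n and R_n, indexed from n = 1. *)
Definition Lnest (j x y n : nat) : nat :=
  iter n.-1 (fun v => oplus j v (oplus j x y)) (oplus j x y).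

Definition Rnest (j x y n : nat) : nat :=
  iter n.-1 (fun v => oplus j x (oplus j v y)) (oplus j x y).

(* Main.v *)
Require Import Defs.
From mathcomp Require Import all_boot.

(** Evaluating the left-hand string repeats [v |-> v (+) (x (+) y)], and in the
    right-hand string every pair of superscripts 2k+1, 2k+2 performs
    [v |-> x (+) (v (+) y)] on the value between the remaining copies of x and y.
    For each of the three operations [v (+) (x (+) y) = x (+) (v (+) y)]: for
    the power both sides are [y ^ (v * x)]. *)

Lemma oplusCA j v x y : oplus j v (oplus j x y) = oplus j x (oplus j v y).
Proof.
case: j => [|[|j]] /=; first exact: addnCA.
  exact: mulnCA.
by rewrite -!expnM mulnC.
Qed.

Lemma Lnest_Rnest j x y n : Lnest j x y n = Rnest j x y n.
Proof. by apply: eq_iter => v; apply: oplusCA. Qed.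

Lemma rcons_nseq (T : Type) n (x : T) : rcons (nseq n x) x = nseq n.+1 x.
Proof. by rewrite -cats1 -(nseqD n 1) addn1. Qed.

(** Ties go to the leftmost sign, hence the strict bound on the left and the weak one on the right.
    Equal sizes of [zs1] and [sg1] align operand and sign positions. *)
Lemma eval_step_min zs1 a b zs2 sg1 j s sg2 :
  size zs1 = size sg1 ->
  all (fun sg => s < superscript sg) sg1 ->
  all (fun sg => s <= superscript sg) sg2 ->
  eval_step (OpString (zs1 ++ a :: b :: zs2) (sg1 ++ (j, s) :: sg2)) =
  OpString (zs1 ++ oplus j a b :: zs2) (sg1 ++ sg2).
Proof.
move=> sz_zs1 gt_sg1 ge_sg2; rewrite /eval_step.
have -> : next_pos (OpString (zs1 ++ a :: b :: zs2) (sg1 ++ (j, s) :: sg2))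
          = size sg1.
  (* No sign of [sg1] passes the minimality test, because [s] itself refutes it. *)
  rewrite /next_pos /= map_cat find_cat ifF; last first.
    apply/hasPn => _ /mapP[sg /(allP gt_sg1) lt_s ->].
    by rewrite all_cat /= [_ <= s]leqNgt lt_s andbF.
  rewrite /= all_cat /= leqnn !all_map size_map.
  have -> : all (preim superscript (leq s)) sg1.
    by apply: sub_all gt_sg1 => sg /ltnW.
  have -> : all (preim superscript (leq s)) sg2 by [].
  by rewrite addn0.
rewrite /contract /= nth_cat ltnn subnn /= -sz_zs1.
rewrite !nth_cat ltnn subnn ltnNge leqnSn subSnn /= take_size_cat //.
congr OpString.
  by rewrite -addn2 drop_cat ltnNge leq_addr addKn /= drop0.
rewrite sz_zs1 take_size_cat //.
by rewrite -addn1 drop_cat ltnNge leq_addr addKn /= drop0.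
Qed.

(** The accumulated value [v] and the first superscript [s] are free, since each step changes
    both. *)
Lemma iter_eval_step_left j z s m v :
  iter m eval_step (OpString (v :: nseq m z) [seq (j, t) | t <- iota s m]) =
  OpString [:: iter m (fun u => oplus j u z) v] [::].
Proof.
elim: m s v => [|m IHm] s v //.
rewrite iterSr (@eval_step_min [::] _ _ _ [::]) ?cat0s //=.
  by rewrite IHm -iterSr.
by rewrite all_map; apply/allP => t; rewrite mem_iota => /andP[/ltnW].
Qed.

(** The offset [a] counts the pairs already performed, so that the induction can advance it along
    with [v]. *)
Lemma iter_eval_step_outward j x y a m v :
  iter m.*2 eval_step
    (OpString (nseq m x ++ v :: nseq m y)
       ([seq (j, 2 * k) | k <- rev (iota a.+1 m)] ++
        [seq (j, (2 * k).+1) | k <- iota a m])) =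
  OpString [:: iter m (fun u => oplus j x (oplus j u y)) v] [::].
Proof.
elim: m a v => [|m IHm] a v //.
have gtE : all (fun sg => (2 * a.+1) < superscript sg)
             [seq (j, 2 * k) | k <- rev (iota a.+2 m)].
  rewrite all_map all_rev; apply/allP => k; rewrite mem_iota => /andP[lt_ak _].
  by rewrite /= ltn_pmul2l.
have geO : all (fun sg => (2 * a.+1) <= superscript sg)
             [seq (j, (2 * k).+1) | k <- iota a.+1 m].
  rewrite all_map; apply/allP => k; rewrite mem_iota => /andP[le_ak _].
  by rewrite /= leqW // leq_pmul2l.
have ltS : (2 * a).+1 < 2 * a.+1 by rewrite mulnS.
(* The least even superscript is the last of its list, so the left half is exposed with [rcons].
   Superscript [2 * a + 1] then acts on [v] and [y], and [2 * a + 2] on [x] and the result. *)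
rewrite doubleS 2!iterSr -(rcons_nseq _ m x) [iota a m.+1]/= map_cons.
rewrite [iota a.+1 m.+1]/= rev_cons map_rcons.
rewrite [nseq m.+1 y]/= eval_step_min; first last.
- by apply: sub_all geO => sg; apply: leq_trans; apply: ltnW.
- rewrite all_rcons ltS; apply: sub_all gtE => sg; exact: ltn_trans.
- by rewrite !size_rcons size_map size_rev size_iota size_nseq.
rewrite !cat_rcons eval_step_min //; last first.
  by rewrite size_map size_rev size_iota size_nseq.
by rewrite IHm -iterSr.
Qed.

Lemma eval_left n i z : 0 < n ->
  eval (copies n i (iota 1 n.-1) z) =
  iter n.-1 (fun u => oplus i.-1 u z) z.
Proof.
case: n => // m _.
by rewrite /eval /copies /= size_map size_iota iter_eval_step_left.
Qed.

Lemma eval_outward n i x y : 0 < n ->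
  eval (join (copies n i (Even n) x) i.-1 0 (copies n i (Odd n) y)) =
  Rnest i.-1 x y n.
Proof.
case: n => // m _.
have -> : join (copies m.+1 i (Even m.+1) x) i.-1 0 (copies m.+1 i (Odd m.+1) y)
    = OpString (nseq m x ++ x :: y :: nseq m y)
        ([seq (i.-1, 2 * k) | k <- rev (iota 1 m)] ++
         (i.-1, 0) :: [seq (i.-1, (2 * k).+1) | k <- iota 0 m]).
  rewrite /join /copies -(rcons_nseq _ m x) /= cat_rcons.
  by rewrite /Even /Odd -map_rev -!map_comp.
(* There are [2 * m + 1] signs: one step for superscript 0, giving the starting value of [Rnest],
   then [m] pairs. *)
rewrite /eval [signs _]/= size_cat /= !size_map size_rev !size_iota addnS addnn.
rewrite iterSr eval_step_min; first last.
- by rewrite all_map; apply/allP.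
- rewrite all_map all_rev; apply/allP => k; rewrite mem_iota => /andP[lt0k _].
  by rewrite /= muln_gt0.
- by rewrite size_map size_rev size_iota size_nseq.
by rewrite iter_eval_step_outward.
Qed.

Theorem theorem6 (i n x y : nat) (hi : 1 <= i <= 3)
  (hn : 0 < n) (hx : 0 < x) (hy : 0 < y) :
  eval (copies n i (iota 1 n.-1) (oplus i.-1 x y)) =
  eval (join (copies n i (Even n) x) i.-1 0 (copies n i (Odd n) y))
  /\ Lnest i.-1 x y n = Rnest i.-1 x y n.
Proof.
split; last exact: Lnest_Rnest.
(* The iteration left by [eval_left] at [oplus i.-1 x y] is [Lnest] unfolded. *)
by rewrite eval_left // eval_outward // -Lnest_Rnest.
Qed.
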